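(* Let $\mathbb F$ be a field, let $\hat H$ be the universal double affine Hecke algebra of type $(C_1^\vee,C_1)$ over $\mathbb F$, and consider the action of the braid group $B_3$ on $\hat H$ described in the context, together with the elements $$x = t^\vee_0 t_1 + (t^\vee_0 t_1)^{-1},\qquad y = t^\vee_1 t_1 + (t^\vee_1 t_1)^{-1},\qquad z = t_0 t_1 + (t_0 t_1)^{-1}$$ of $\hat H$. The element $a$ of $B_3$ fixes each of $x$, $y$, $z$. The generator $b$ sends $x\mapsto y\mapsto z\mapsto x$. The generator $c$ swaps $x$, $y$ and sends $z\mapsto z'$, where $$Qz+Q^{-1}z'+xy \;=\; Q^{-1}z+Qz'+yx \;=\; (t^\vee_0+t^{\vee -1}_0)(t^\vee_1+t^{\vee -1}_1)+(t_0+t^{-1}_0)(Q^{-1}t_1+Qt^{-1}_1).$$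
   Context: All algebras are associative with $1$. $\hat H$ is the $\mathbb F$-algebra defined by generators $t_i^{\pm1}$, $(t_i^\vee)^{\pm1}$ $(i=0,1)$ and relations: $t_it_i^{-1}=t_i^{-1}t_i=1$, $t^\vee_it^{\vee -1}_i=t^{\vee -1}_it^\vee_i=1$; $t_i+t_i^{-1}$ is central and $t^\vee_i+t^{\vee -1}_i$ is central $(i=0,1)$; $t^\vee_0t_0t^\vee_1t_1$ is central. Here $t^{\vee -1}_i=(t^\vee_i)^{-1}$. The element $t^\vee_0t_0t^\vee_1t_1$ is invertible and $Q$ denotes its inverse. Artin's braid group $B_3$ is the group defined by generators $b,c$ and the relation $b^3=c^2$; put $a=b^3=c^2$. $B_3$ acts on $\hat H$ as a group of $\mathbb F$-algebra automorphisms such that $a(h)=t_1^{-1}ht_1$ for all $h\in\hat H$, and $$b:\ t^\vee_0\mapsto t_1^{-1}t^\vee_1t_1,\quad t_0\mapsto t^\vee_0,\quad t^\vee_1\mapsto t_0,\quad t_1\mapsto t_1;$$ $$c:\ t^\vee_0\mapsto t_1^{-1}t^\vee_1t_1,\quad t_0\mapsto t^\vee_0t_0t^{\vee -1}_0,\quad t^\vee_1\mapsto t^\vee_0,\quad t_1\mapsto t_1.$$ *)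

(* Defs.v *)
From HB Require Import structures.
From mathcomp Require Import all_boot all_algebra.
From mathcomp Require Import boolp.

Set Implicit Arguments.
Unset Strict Implicit.
Unset Printing Implicit Defensive.

Import GRing.Theory.
Local Open Scope quotient_scope.
Local Open Scope ring_scope.

(* The algebra [Hhat F] is the set of formal expressions in the generators,   *)
(* modulo the least congruence containing the axioms of unital associative    *)
(* F-algebras and the defining relations.                                     *)

Inductive Hgen := T0 | T1 | Tv0 | Tv1.

Inductive Hterm (F : Type) :=
  | HScal of F
  | HGen of Hgen
  | HInv of Hgen
  | HAdd of Hterm F & Hterm F
  | HOpp of Hterm F
  | HMul of Hterm F & Hterm F.
Arguments HGen {F}.
Arguments HInv {F}.

HB.instance Definition _ (F : Type) := gen_eqMixin (Hterm F).
HB.instance Definition _ (F : Type) := gen_choiceMixin (Hterm F).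

Inductive Hrel (F : fieldType) : Hterm F -> Hterm F -> Prop :=
  | Hrel_mulV u : Hrel (HMul (HGen u) (HInv u)) (HScal 1)
  | Hrel_Vmul u : Hrel (HMul (HInv u) (HGen u)) (HScal 1)
  | Hrel_central u h :
      Hrel (HMul (HAdd (HGen u) (HInv u)) h) (HMul h (HAdd (HGen u) (HInv u)))
  | Hrel_Qcentral h :
      let q := HMul (HMul (HMul (HGen Tv0) (HGen T0)) (HGen Tv1)) (HGen T1) in
      Hrel (HMul q h) (HMul h q).

Inductive Hcong (F : fieldType) : Hterm F -> Hterm F -> Prop :=
  | Hc_rel p q : Hrel p q -> Hcong p q
  | Hc_refl p : Hcong p p
  | Hc_sym p q : Hcong p q -> Hcong q p
  | Hc_trans p q r : Hcong p q -> Hcong q r -> Hcong p r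
  | Hc_add p p' q q' : Hcong p p' -> Hcong q q' -> Hcong (HAdd p q) (HAdd p' q')
  | Hc_opp p p' : Hcong p p' -> Hcong (HOpp p) (HOpp p')
  | Hc_mul p p' q q' : Hcong p p' -> Hcong q q' -> Hcong (HMul p q) (HMul p' q')
  | Hc_addA p q r : Hcong (HAdd p (HAdd q r)) (HAdd (HAdd p q) r)
  | Hc_addC p q : Hcong (HAdd p q) (HAdd q p)
  | Hc_add0 p : Hcong (HAdd (HScal 0) p) p
  | Hc_addN p : Hcong (HAdd (HOpp p) p) (HScal 0)
  | Hc_mulA p q r : Hcong (HMul p (HMul q r)) (HMul (HMul p q) r)
  | Hc_mul1 p : Hcong (HMul (HScal 1) p) p
  | Hc_mulr1 p : Hcong (HMul p (HScal 1)) p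
  | Hc_mulDl p q r : Hcong (HMul (HAdd p q) r) (HAdd (HMul p r) (HMul q r))
  | Hc_mulDr p q r : Hcong (HMul p (HAdd q r)) (HAdd (HMul p q) (HMul p r))
  | Hc_scalD a b : Hcong (HScal (a + b)) (HAdd (HScal a) (HScal b))
  | Hc_scalM a b : Hcong (HScal (a * b)) (HMul (HScal a) (HScal b))
  | Hc_scalC a p : Hcong (HMul (HScal a) p) (HMul p (HScal a)).

(* [g u false], [g u true] are the images of the generator u and its inverse. *)
Fixpoint Heval (F : fieldType) (A : algType F) (g : Hgen -> bool -> A)
    (p : Hterm F) : A :=
  match p with
  | HScal a => a%:A
  | HGen u => g u false
  | HInv u => g u true
  | HAdd p q => Heval g p + Heval g q
  | HOpp p => - Heval g p
  | HMul p q => Heval g p * Heval g q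
  end.

Definition Hrespects (F : fieldType) (A : algType F) (g : Hgen -> bool -> A) :=
  [/\ forall u, g u false * g u true = 1,
      forall u, g u true * g u false = 1,
      forall u v s, GRing.comm (g u false + g u true) (g v s) &
      forall v s, GRing.comm
        (g Tv0 false * g T0 false * g Tv1 false * g T1 false) (g v s)].

Lemma Heval_comm (F : fieldType) (A : algType F) (g : Hgen -> bool -> A) r p :
  (forall v s, GRing.comm r (g v s)) -> GRing.comm r (Heval g p).
Proof.
move=> cr; elim: p => /= [a|u|u|p IHp q IHq|p IHp|p IHp q IHq] //.
- by rewrite /GRing.comm -scalerAr -scalerAl mulr1 mul1r.
- exact: commrD.
- exact: commrN.
- exact: commrM.
Qed.

Lemma Heval_cong (F : fieldType) (A : algType F) (g : Hgen -> bool -> A) p q :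
  Hrespects g -> Hcong p q -> Heval g p = Heval g q.
Proof.
case=> gV Vg gC QC; elim=> //=.
- move=> {}p {}q [u|u|u h|h] /=; rewrite ?scale1r //.
    by apply: Heval_comm => v s; apply: gC.
  by apply: Heval_comm => v s; apply: QC.
- by move=> ? ? ? _ -> _ ->.
- by move=> ? ? ? ? _ -> _ ->.
- by move=> ? ? _ ->.
- by move=> ? ? ? ? _ -> _ ->.
- by move=> *; rewrite addrA.
- by move=> *; rewrite addrC.
- by move=> *; rewrite scale0r add0r.
- by move=> *; rewrite scale0r addNr.
- by move=> *; rewrite mulrA.
- by move=> *; rewrite scale1r mul1r.
- by move=> *; rewrite scale1r mulr1.
- by move=> *; rewrite mulrDl.
- by move=> *; rewrite mulrDr.
- by move=> *; rewrite scalerDl.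
- by move=> *; rewrite -scalerAl mul1r scalerA.
- by move=> *; rewrite -scalerAl -scalerAr mulr1 mul1r.
Qed.

Section HhatQuotient.
Variable F : fieldType.

Definition Hequiv (p q : Hterm F) : bool := `[< Hcong p q >].

Lemma Hequiv_refl : reflexive Hequiv.
Proof. by move=> p; apply/asboolP/Hc_refl. Qed.
Lemma Hequiv_sym : symmetric Hequiv.
Proof. by move=> p q; apply/asboolP/asboolP; apply: Hc_sym. Qed.
Lemma Hequiv_trans : transitive Hequiv.
Proof.
by move=> q p r /asboolP pq /asboolP qr; apply/asboolP; apply: Hc_trans qr.
Qed.

Canonical Hequiv_equiv := EquivRel Hequiv Hequiv_refl Hequiv_sym Hequiv_trans.

Definition Hhat := {eq_quot Hequiv}.
HB.instance Definition _ := Choice.on Hhat.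

Definition Hpi (p : Hterm F) : Hhat := \pi_({eq_quot Hequiv}) p.
Definition Hrepr (x : Hhat) : Hterm F := repr (x : {eq_quot Hequiv}).

Lemma HreprK x : Hpi (Hrepr x) = x. Proof. exact: reprK. Qed.

Lemma HpiP p q : Hpi p = Hpi q <-> Hcong p q.
Proof. by split=> [/eqmodP/asboolP//|pq]; apply/eqmodP/asboolP. Qed.

Lemma Hpi_eq p q : Hcong p q -> Hpi p = Hpi q. Proof. by move/HpiP. Qed.

Lemma Hrepr_pi p : Hcong (Hrepr (Hpi p)) p.
Proof. by apply/HpiP; rewrite HreprK. Qed.

Lemma Hhat_ind (P : Hhat -> Prop) : (forall p, P (Hpi p)) -> forall x, P x.
Proof. by move=> PP x; rewrite -(HreprK x). Qed.

Definition Hhat_add x y := Hpi (HAdd (Hrepr x) (Hrepr y)).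
Definition Hhat_opp x := Hpi (HOpp (Hrepr x)).
Definition Hhat_mul x y := Hpi (HMul (Hrepr x) (Hrepr y)).
Definition Hhat_scale a x := Hpi (HMul (HScal a) (Hrepr x)).

Lemma Hhat_addE p q : Hhat_add (Hpi p) (Hpi q) = Hpi (HAdd p q).
Proof. by apply/Hpi_eq/Hc_add; apply: Hrepr_pi. Qed.
Lemma Hhat_oppE p : Hhat_opp (Hpi p) = Hpi (HOpp p).
Proof. by apply/Hpi_eq/Hc_opp; apply: Hrepr_pi. Qed.
Lemma Hhat_mulE p q : Hhat_mul (Hpi p) (Hpi q) = Hpi (HMul p q).
Proof. by apply/Hpi_eq/Hc_mul; apply: Hrepr_pi. Qed.
Lemma Hhat_scaleE a p : Hhat_scale a (Hpi p) = Hpi (HMul (HScal a) p).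
Proof. by apply/Hpi_eq/Hc_mul; [apply: Hc_refl|apply: Hrepr_pi]. Qed.

Let HhatE := (Hhat_addE, Hhat_oppE, Hhat_mulE, Hhat_scaleE).

Fact Hhat_addA : associative Hhat_add.
Proof.
by do 3![elim/Hhat_ind=> ?]; rewrite !HhatE; apply/Hpi_eq/Hc_addA.
Qed.
Fact Hhat_addC : commutative Hhat_add.
Proof. by do 2![elim/Hhat_ind=> ?]; rewrite !HhatE; apply/Hpi_eq/Hc_addC. Qed.
Fact Hhat_add0 : left_id (Hpi (HScal 0)) Hhat_add.
Proof. by elim/Hhat_ind=> ?; rewrite !HhatE; apply/Hpi_eq/Hc_add0. Qed.
Fact Hhat_addN : left_inverse (Hpi (HScal 0)) Hhat_opp Hhat_add.
Proof. by elim/Hhat_ind=> ?; rewrite !HhatE; apply/Hpi_eq/Hc_addN. Qed.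

HB.instance Definition _ :=
  GRing.isZmodule.Build Hhat Hhat_addA Hhat_addC Hhat_add0 Hhat_addN.

Fact Hhat_mulA : associative Hhat_mul.
Proof.
by do 3![elim/Hhat_ind=> ?]; rewrite !HhatE; apply/Hpi_eq/Hc_mulA.
Qed.
Fact Hhat_mul1 : left_id (Hpi (HScal 1)) Hhat_mul.
Proof. by elim/Hhat_ind=> ?; rewrite !HhatE; apply/Hpi_eq/Hc_mul1. Qed.
Fact Hhat_mulr1 : right_id (Hpi (HScal 1)) Hhat_mul.
Proof. by elim/Hhat_ind=> ?; rewrite !HhatE; apply/Hpi_eq/Hc_mulr1. Qed.
Fact Hhat_mulDl : left_distributive Hhat_mul +%R.
Proof.
do 3![elim/Hhat_ind=> ?]; rewrite /GRing.add /= !HhatE.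
exact/Hpi_eq/Hc_mulDl.
Qed.
Fact Hhat_mulDr : right_distributive Hhat_mul +%R.
Proof.
do 3![elim/Hhat_ind=> ?]; rewrite /GRing.add /= !HhatE.
exact/Hpi_eq/Hc_mulDr.
Qed.
(* All generators may be sent to 1 in F, whence 1 != 0 in [Hhat F]. *)
Fact Hhat_1neq0 : Hpi (HScal 1) != 0 :> Hhat.
Proof.
apply/eqP => /HpiP cong10.
have rg : Hrespects (A := F^o) (fun _ _ => 1).
  by split=> *; rewrite /GRing.comm ?mulr1 // mul1r.
have /= := Heval_cong rg cong10.
by rewrite scale1r scale0r => /eqP; rewrite oner_eq0.
Qed.

HB.instance Definition _ := GRing.Zmodule_isNzRing.Build Hhat
  Hhat_mulA Hhat_mul1 Hhat_mulr1 Hhat_mulDl Hhat_mulDr Hhat_1neq0.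

Lemma HpiD p q : Hpi (HAdd p q) = Hpi p + Hpi q.
Proof. by rewrite -Hhat_addE. Qed.
Lemma HpiN p : Hpi (HOpp p) = - Hpi p.
Proof. by rewrite -Hhat_oppE. Qed.
Lemma HpiM p q : Hpi (HMul p q) = Hpi p * Hpi q.
Proof. by rewrite -Hhat_mulE. Qed.
Lemma Hpi1 : Hpi (HScal 1) = 1. Proof. by []. Qed.

Lemma Hhat_scaleEM a x : Hhat_scale a x = Hpi (HScal a) * x.
Proof. by elim/Hhat_ind: x => p; rewrite Hhat_scaleE HpiM. Qed.
Lemma Hpi_scalM a b : Hpi (HScal (a * b)) = Hpi (HScal a) * Hpi (HScal b).
Proof. by rewrite -HpiM; apply/Hpi_eq/Hc_scalM. Qed.
Lemma Hpi_scalC a x : Hpi (HScal a) * x = x * Hpi (HScal a).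
Proof. by elim/Hhat_ind: x => p; rewrite -!HpiM; apply/Hpi_eq/Hc_scalC. Qed.

Fact Hhat_scaleA a b x : Hhat_scale a (Hhat_scale b x) = Hhat_scale (a * b) x.
Proof. by rewrite !Hhat_scaleEM Hpi_scalM mulrA. Qed.
Fact Hhat_scale1 : left_id 1 Hhat_scale.
Proof. by move=> x; rewrite Hhat_scaleEM Hpi1 mul1r. Qed.
Fact Hhat_scaleDr : right_distributive Hhat_scale +%R.
Proof. by move=> a x y; rewrite !Hhat_scaleEM mulrDr. Qed.
Fact Hhat_scaleDl x : {morph Hhat_scale^~ x : a b / a + b}.
Proof.
move=> a b; rewrite !Hhat_scaleEM -mulrDl -HpiD; congr (_ * _).
exact/Hpi_eq/Hc_scalD.
Qed.

HB.instance Definition _ := GRing.Zmodule_isLmodule.Build F Hhat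
  Hhat_scaleA Hhat_scale1 Hhat_scaleDr Hhat_scaleDl.

Lemma Hhat_scalerE a (x : Hhat) : a *: x = Hpi (HScal a) * x.
Proof. exact: Hhat_scaleEM. Qed.

Fact Hhat_scaleAl a (x y : Hhat) : a *: (x * y) = a *: x * y.
Proof. by rewrite !Hhat_scalerE mulrA. Qed.
HB.instance Definition _ := GRing.Lmodule_isLalgebra.Build F Hhat Hhat_scaleAl.

Fact Hhat_scaleAr a (x y : Hhat) : a *: (x * y) = x * (a *: y).
Proof. by rewrite !Hhat_scalerE !mulrA Hpi_scalC. Qed.
HB.instance Definition _ := GRing.Lalgebra_isAlgebra.Build F Hhat Hhat_scaleAr.

Definition Hhat_unit : pred Hhat :=
  fun x => `[< exists y, y * x = 1 /\ x * y = 1 >].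
Definition Hhat_inv (x : Hhat) : Hhat :=
  if pselect (exists y, y * x = 1 /\ x * y = 1) is left ex then sval (cid ex)
  else x.

Fact Hhat_mulVr : {in Hhat_unit, left_inverse 1 Hhat_inv *%R}.
Proof.
move=> x /asboolP ux; rewrite /Hhat_inv.
by case: pselect => // ?; case: cid => y [].
Qed.
Fact Hhat_mulrV : {in Hhat_unit, right_inverse 1 Hhat_inv *%R}.
Proof.
move=> x /asboolP ux; rewrite /Hhat_inv.
by case: pselect => // ?; case: cid => y [].
Qed.
Fact Hhat_unitP (x y : Hhat) : y * x = 1 /\ x * y = 1 -> Hhat_unit x.
Proof. by move=> xy; apply/asboolP; exists y. Qed.
Fact Hhat_inv_out : {in [predC Hhat_unit], Hhat_inv =1 id}.
Proof.
move=> x /negP nux; rewrite /Hhat_inv.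
by case: pselect => // ux; case: nux; apply/asboolP.
Qed.

HB.instance Definition _ := GRing.NzRing_hasMulInverse.Build Hhat
  Hhat_mulVr Hhat_mulrV Hhat_unitP Hhat_inv_out.

End HhatQuotient.

HB.instance Definition _ (F : fieldType) := GRing.UnitAlgebra.on (Hhat F).

Definition Hgenv {F : fieldType} (u : Hgen) : Hhat F := Hpi (HGen u).

Notation t0 := (Hgenv T0).
Notation t1 := (Hgenv T1).
Notation tv0 := (Hgenv Tv0).
Notation tv1 := (Hgenv Tv1).

Section Presentation.
Variable F : fieldType.
Local Notation H := (Hhat F).
Local Notation tg := (@Hgenv F).

Lemma HgenvV u : Hpi (HInv u) = (tg u)^-1.
Proof.
have uV : tg u * Hpi (HInv u) = 1.
  by rewrite -HpiM -Hpi1; apply/Hpi_eq/Hc_rel/Hrel_mulV.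
have Vu : Hpi (HInv u) * tg u = 1.
  by rewrite -HpiM -Hpi1; apply/Hpi_eq/Hc_rel/Hrel_Vmul.
have uu : tg u \is a GRing.unit by apply/unitrP; exists (Hpi (HInv u)).
by apply: (mulrI uu); rewrite uV divrr.
Qed.

Lemma Hgenv_unit u : tg u \is a GRing.unit.
Proof.
apply/unitrP; exists (Hpi (HInv u)).
by split; rewrite -HpiM -Hpi1; apply/Hpi_eq/Hc_rel; constructor.
Qed.

Lemma Hgenv_central u (h : H) : (tg u + (tg u)^-1) * h = h * (tg u + (tg u)^-1).
Proof.
elim/Hhat_ind: h => p; rewrite -HgenvV /Hgenv -!HpiD -!HpiM.
exact/Hpi_eq/Hc_rel/Hrel_central.
Qed.

Lemma Hprod_central (h : H) :
  (tv0 * t0 * tv1 * t1) * h = h * (tv0 * t0 * tv1 * t1).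
Proof.
elim/Hhat_ind: h => p; rewrite /Hgenv -!HpiM.
exact/Hpi_eq/Hc_rel/Hrel_Qcentral.
Qed.

Section Lift.
Variables (A : unitAlgType F) (g : Hgen -> A).

Definition Hadmissible :=
  [/\ forall u, g u \is a GRing.unit,
      forall u v, GRing.comm (g u + (g u)^-1) (g v) &
      forall v, GRing.comm (g Tv0 * g T0 * g Tv1 * g T1) (g v)].

Let g2 u (s : bool) := if s then (g u)^-1 else g u.

Definition Hlift_fun of Hadmissible := fun x : H => Heval g2 (Hrepr x).

Hypothesis gP : Hadmissible.

Let g2P : Hrespects g2.
Proof.
have [gU gC gQ] := gP.
split=> [u|u|u v []|v []]; rewrite /g2 ?mulrV ?mulVr //.
  exact: commrV (gC _ _).
exact: commrV (gQ _).
Qed.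

Local Notation f := (Hlift_fun gP).

Let fE p : f (Hpi p) = Heval g2 p.
Proof. by apply: Heval_cong => //; apply: Hrepr_pi. Qed.

Fact Hlift_is_zmod : zmod_morphism f.
Proof.
move=> x y; elim/Hhat_ind: x => p; elim/Hhat_ind: y => q.
by rewrite -HpiN -HpiD !fE.
Qed.
Fact Hlift_is_monoid : monoid_morphism f.
Proof.
split=> [|x y]; first by rewrite -Hpi1 fE /= scale1r.
by elim/Hhat_ind: x => p; elim/Hhat_ind: y => q; rewrite -HpiM !fE.
Qed.
Fact Hlift_is_scalable : scalable f.
Proof.
move=> a x; elim/Hhat_ind: x => p.
by rewrite Hhat_scalerE -HpiM !fE /= -scalerAl mul1r.
Qed.
HB.instance Definition _ := GRing.isZmodMorphism.Build H A f Hlift_is_zmod.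
HB.instance Definition _ := GRing.isMonoidMorphism.Build H A f Hlift_is_monoid.
HB.instance Definition _ := GRing.isScalable.Build F H A *:%R f Hlift_is_scalable.

Definition Hlift : {lrmorphism H -> A} := f.

Lemma Hlift_gen u : Hlift (tg u) = g u. Proof. exact: fE. Qed.

End Lift.

Lemma lrmorph_Hhat_ext (A : unitAlgType F) (f1 f2 : {lrmorphism H -> A}) :
  (forall u, f1 (tg u) = f2 (tg u)) -> f1 =1 f2.
Proof.
move=> e x; elim/Hhat_ind: x => p.
elim: p => [a|u|u|p IHp q IHq|p IHp|p IHp q IHq].
- by rewrite -[Hpi _]mulr1 -Hhat_scalerE !linearZ /= !rmorph1.
- exact: e.
- by rewrite HgenvV (rmorphV f1 (Hgenv_unit u)) (rmorphV f2 (Hgenv_unit u)) /= e.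
- by rewrite HpiD !rmorphD /= IHp IHq.
- by rewrite HpiN !rmorphN /= IHp.
- by rewrite HpiM !rmorphM /= IHp IHq.
Qed.

End Presentation.

Inductive B3term := BOne | Bb | Bc | BMul of B3term & B3term | BInv of B3term.

HB.instance Definition _ := gen_eqMixin B3term.
HB.instance Definition _ := gen_choiceMixin B3term.

Inductive Bcong : B3term -> B3term -> Prop :=
  | Bcong_braid : Bcong (BMul Bb (BMul Bb Bb)) (BMul Bc Bc)
  | Bcong_refl p : Bcong p p
  | Bcong_sym p q : Bcong p q -> Bcong q p
  | Bcong_trans p q r : Bcong p q -> Bcong q r -> Bcong p r
  | Bcong_mul p p' q q' :
      Bcong p p' -> Bcong q q' -> Bcong (BMul p q) (BMul p' q')
  | Bcong_inv p p' : Bcong p p' -> Bcong (BInv p) (BInv p')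
  | Bcong_mulA p q r : Bcong (BMul p (BMul q r)) (BMul (BMul p q) r)
  | Bcong_mul1 p : Bcong (BMul BOne p) p
  | Bcong_mulr1 p : Bcong (BMul p BOne) p
  | Bcong_mulV p : Bcong (BMul (BInv p) p) BOne
  | Bcong_mulrV p : Bcong (BMul p (BInv p)) BOne.

Definition Bequiv (p q : B3term) : bool := `[< Bcong p q >].

Lemma Bequiv_refl : reflexive Bequiv.
Proof. by move=> p; apply/asboolP/Bcong_refl. Qed.
Lemma Bequiv_sym : symmetric Bequiv.
Proof. by move=> p q; apply/asboolP/asboolP; apply: Bcong_sym. Qed.
Lemma Bequiv_trans : transitive Bequiv.
Proof.
by move=> q p r /asboolP pq /asboolP qr; apply/asboolP; apply: Bcong_trans qr.
Qed.

Canonical Bequiv_equiv := EquivRel Bequiv Bequiv_refl Bequiv_sym Bequiv_trans.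

Definition B3 := {eq_quot Bequiv}.
HB.instance Definition _ := Choice.on B3.

Definition Bpi (p : B3term) : B3 := \pi_({eq_quot Bequiv}) p.
Definition Brepr (x : B3) : B3term := repr (x : {eq_quot Bequiv}).

Lemma BreprK x : Bpi (Brepr x) = x. Proof. exact: reprK. Qed.

Lemma BpiP p q : Bpi p = Bpi q <-> Bcong p q.
Proof. by split=> [/eqmodP/asboolP//|pq]; apply/eqmodP/asboolP. Qed.

Lemma Bpi_eq p q : Bcong p q -> Bpi p = Bpi q. Proof. by move/BpiP. Qed.

Lemma Brepr_pi p : Bcong (Brepr (Bpi p)) p.
Proof. by apply/BpiP; rewrite BreprK. Qed.

Lemma B3_ind (P : B3 -> Prop) : (forall p, P (Bpi p)) -> forall x, P x.
Proof. by move=> PP x; rewrite -(BreprK x). Qed.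

Definition B3_mul x y := Bpi (BMul (Brepr x) (Brepr y)).
Definition B3_inv x := Bpi (BInv (Brepr x)).

Lemma B3_mulE p q : B3_mul (Bpi p) (Bpi q) = Bpi (BMul p q).
Proof. by apply/Bpi_eq/Bcong_mul; apply: Brepr_pi. Qed.
Lemma B3_invE p : B3_inv (Bpi p) = Bpi (BInv p).
Proof. by apply/Bpi_eq/Bcong_inv; apply: Brepr_pi. Qed.

Fact B3_mulA : associative B3_mul.
Proof.
by do 3![elim/B3_ind=> ?]; rewrite !B3_mulE; apply/Bpi_eq/Bcong_mulA.
Qed.
Fact B3_mul1 : left_id (Bpi BOne) B3_mul.
Proof. by elim/B3_ind=> ?; rewrite B3_mulE; apply/Bpi_eq/Bcong_mul1. Qed.
Fact B3_mulr1 : right_id (Bpi BOne) B3_mul.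
Proof. by elim/B3_ind=> ?; rewrite B3_mulE; apply/Bpi_eq/Bcong_mulr1. Qed.
Fact B3_mulV : left_inverse (Bpi BOne) B3_inv B3_mul.
Proof.
by elim/B3_ind=> ?; rewrite B3_invE B3_mulE; apply/Bpi_eq/Bcong_mulV.
Qed.
Fact B3_mulrV : right_inverse (Bpi BOne) B3_inv B3_mul.
Proof.
by elim/B3_ind=> ?; rewrite B3_invE B3_mulE; apply/Bpi_eq/Bcong_mulrV.
Qed.

HB.instance Definition _ :=
  isGroup.Build B3 B3_mulA B3_mul1 B3_mulr1 B3_mulV B3_mulrV.

Definition B3b : B3 := Bpi Bb.
Definition B3c : B3 := Bpi Bc.
Definition B3a : B3 := (B3b ^+ 3)%g.

Lemma BpiM p q : Bpi (BMul p q) = (Bpi p * Bpi q)%g.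
Proof. by rewrite -B3_mulE. Qed.

Lemma B3aE : B3a = (B3c ^+ 2)%g.
Proof.
rewrite /B3a /B3b /B3c expgS !expg2.
by have := Bpi_eq Bcong_braid; rewrite !BpiM.
Qed.

(* Each [act g] is an automorphism by [B3act1] and [B3actM]. *)
Record B3_action (F : fieldType) (act : B3 -> {lrmorphism Hhat F -> Hhat F})
    : Prop := {
  B3act1 : act 1%g =1 id;
  B3actM : forall g h, act (g * h)%g =1 act g \o act h;
  B3act_a : forall h, act B3a h = t1^-1 * h * t1;
  B3act_b_tv0 : act B3b tv0 = t1^-1 * tv1 * t1;
  B3act_b_t0 : act B3b t0 = tv0;
  B3act_b_tv1 : act B3b tv1 = t0;
  B3act_b_t1 : act B3b t1 = t1;
  B3act_c_tv0 : act B3c tv0 = t1^-1 * tv1 * t1;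
  B3act_c_t0 : act B3c t0 = tv0 * t0 * tv0^-1;
  B3act_c_tv1 : act B3c tv1 = tv0;
  B3act_c_t1 : act B3c t1 = t1
}.

Definition HQ {F : fieldType} : Hhat F := (tv0 * t0 * tv1 * t1)^-1.
Definition Hx {F : fieldType} : Hhat F := tv0 * t1 + (tv0 * t1)^-1.
Definition Hy {F : fieldType} : Hhat F := tv1 * t1 + (tv1 * t1)^-1.
Definition Hz {F : fieldType} : Hhat F := t0 * t1 + (t0 * t1)^-1.

Section Conjugation.
Variables (F : fieldType) (A : unitAlgType F) (s : A).

Definition Hconj of s \is a GRing.unit := fun h : A => s^-1 * h * s.

Hypothesis sU : s \is a GRing.unit.

Fact Hconj_is_zmod : zmod_morphism (Hconj sU).
Proof. by move=> x y; rewrite /Hconj mulrBr mulrBl. Qed.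
Fact Hconj_is_monoid : monoid_morphism (Hconj sU).
Proof.
split=> [|x y]; first by rewrite /Hconj mulr1 mulVr.
by rewrite /Hconj !mulrA mulrK.
Qed.
Fact Hconj_is_scalable : scalable (Hconj sU).
Proof. by move=> a x; rewrite /Hconj -scalerAr -scalerAl. Qed.
HB.instance Definition _ := GRing.isZmodMorphism.Build A A (Hconj sU) Hconj_is_zmod.
HB.instance Definition _ :=
  GRing.isMonoidMorphism.Build A A (Hconj sU) Hconj_is_monoid.
HB.instance Definition _ :=
  GRing.isScalable.Build F A A *:%R (Hconj sU) Hconj_is_scalable.

Lemma HconjV x : x \is a GRing.unit -> (Hconj sU x)^-1 = Hconj sU x^-1.
Proof. by move=> xU; rewrite (rmorphV (Hconj sU) xU). Qed.

Lemma Hconj_unit x : x \is a GRing.unit -> Hconj sU x \is a GRing.unit.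
Proof. exact: rmorph_unit. Qed.

Lemma Hconj_central r : (forall h, r * h = h * r) -> Hconj sU r = r.
Proof. by move=> cr; rewrite /Hconj -cr mulrVK. Qed.

End Conjugation.

Section ActionExists.
Variable F : fieldType.
Local Notation H := (Hhat F).

Let U := @Hgenv_unit F.
Let t1V : (t1 : H)^-1 \is a GRing.unit. Proof. by rewrite unitrV U. Qed.
Let ca : {lrmorphism H -> H} := Hconj (U T1).
Let ci : {lrmorphism H -> H} := Hconj t1V.
Let tv0V : (tv0 : H)^-1 \is a GRing.unit. Proof. by rewrite unitrV U. Qed.

Let c0E h : Hconj tv0V h = tv0 * h * tv0^-1.
Proof. by rewrite /Hconj invrK. Qed.

Let caE h : ca h = t1^-1 * h * t1. Proof. by []. Qed.

Let bgen u : H := match u with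
  | T0 => tv0 | T1 => t1 | Tv0 => ca tv1 | Tv1 => t0 end.
Let cgen u : H := match u with
  | T0 => Hconj tv0V t0 | T1 => t1 | Tv0 => ca tv1 | Tv1 => tv0 end.

Let rotQ : tv1 * t1 * tv0 * t0 = tv0 * t0 * tv1 * t1 :> H.
Proof.
have := @Hprod_central F (tv0 * t0).
rewrite -!mulrA => /(mulrI (U Tv0))/(mulrI (U T0)).
by rewrite !mulrA.
Qed.

Let rotQ' : t0 * tv1 * t1 * tv0 = tv0 * t0 * tv1 * t1 :> H.
Proof.
have := @Hprod_central F tv0.
by rewrite -!mulrA => /(mulrI (U Tv0)); rewrite !mulrA.
Qed.

Let conj_trace s (sU : s \is a GRing.unit) u h :
  (Hconj sU (Hgenv u) + (Hconj sU (Hgenv u))^-1) * h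
    = h * (Hconj sU (Hgenv u) + (Hconj sU (Hgenv u))^-1) :> H.
Proof.
rewrite HconjV ?U // -(rmorphD (Hconj sU)) /= Hconj_central.
  exact: Hgenv_central.
exact: Hgenv_central.
Qed.

Let conjQ (h : H) : (ca tv1 * tv0 * t0 * t1) * h = h * (ca tv1 * tv0 * t0 * t1).
Proof.
have -> : ca tv1 * tv0 * t0 * t1 = tv0 * t0 * tv1 * t1.
  rewrite -[RHS](Hconj_central (U T1) (@Hprod_central F)) -rotQ.
  by rewrite /ca /= /Hconj !mulrA.
exact: Hprod_central.
Qed.

Let bgenP : Hadmissible bgen.
Proof.
split=> [u|u v|v].
- by case: u => /=; rewrite ?U ?Hconj_unit ?U.
- by case: u => /=; rewrite /GRing.comm ?Hgenv_central ?conj_trace.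
- exact: conjQ.
Qed.

Let cgenP : Hadmissible cgen.
Proof.
split=> [u|u v|v].
- by case: u => /=; rewrite ?U ?Hconj_unit ?U.
- by case: u => /=; rewrite /GRing.comm ?Hgenv_central ?conj_trace.
- have e : ca tv1 * Hconj tv0V t0 * tv0 * t1 = ca tv1 * tv0 * t0 * t1.
    by rewrite c0E !mulrA mulrVK ?U.
  by rewrite /GRing.comm e; apply: conjQ.
Qed.

Let fb : {lrmorphism H -> H} := Hlift bgenP.
Let fc : {lrmorphism H -> H} := Hlift cgenP.

Let fbE u : fb (Hgenv u) = bgen u. Proof. exact: Hlift_gen. Qed.
Let fcE u : fc (Hgenv u) = cgen u. Proof. exact: Hlift_gen. Qed.

Let fb_ca h : fb (ca h) = ca (fb h).
Proof.
by rewrite !caE !(rmorphM fb) (rmorphV fb (U T1)) /= (fbE T1).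
Qed.
Let fc_ca h : fc (ca h) = ca (fc h).
Proof.
by rewrite !caE !(rmorphM fc) (rmorphV fc (U T1)) /= (fcE T1).
Qed.

Let ca_t1 : ca t1 = t1. Proof. by rewrite caE mulVr ?U // mul1r. Qed.

Let fbP : [/\ fb t0 = tv0, fb t1 = t1, fb tv0 = ca tv1 & fb tv1 = t0].
Proof. by split; apply: fbE. Qed.
Let fcP : [/\ fc t0 = tv0 * t0 / tv0, fc t1 = t1, fc tv0 = ca tv1 & fc tv1 = tv0].
Proof. by rewrite -c0E; split; apply: fcE. Qed.

Let fb3 : fb \o fb \o fb =1 ca.
Proof.
have [e0 e1 f0 f1] := fbP.
apply: lrmorph_Hhat_ext; case.
- by change (fb (fb (fb t0)) = ca t0); rewrite e0 f0 fb_ca f1.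
- by change (fb (fb (fb t1)) = ca t1); rewrite !e1 ca_t1.
- by change (fb (fb (fb tv0)) = ca tv0); rewrite f0 !fb_ca f1 e0.
- by change (fb (fb (fb tv1)) = ca tv1); rewrite f1 e0 f0.
Qed.

Let fc2 : fc \o fc =1 ca.
Proof.
have [e0 e1 f0 f1] := fcP.
apply: lrmorph_Hhat_ext; case.
- change (fc (fc t0) = ca t0).
  rewrite e0 !(rmorphM fc) (rmorphV fc (U Tv0)) /= e0 f0.
  have cU : ca tv1 \is a GRing.unit by exact: Hconj_unit.
  apply: (mulIr cU); rewrite mulrVK //; apply: (mulIr (U Tv0)).
  rewrite !mulrA mulrVK ?U // !caE -!mulrA; congr (_ * _).
  by rewrite mulVKr ?U // !mulrA rotQ' -rotQ.
- by change (fc (fc t1) = ca t1); rewrite !e1 ca_t1.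
- by change (fc (fc tv0) = ca tv0); rewrite f0 fc_ca f1.
- by change (fc (fc tv1) = ca tv1); rewrite f1 f0.
Qed.

Let caK : cancel ca ci.
Proof. by move=> h; rewrite caE /ci /= /Hconj invrK !mulrA mulrV ?U // mul1r mulrK ?U. Qed.
Let ciK : cancel ci ca.
Proof. by move=> h; rewrite caE /ci /= /Hconj invrK !mulrA mulVr ?U // mul1r mulrVK ?U. Qed.

Let ci_comm (f : {lrmorphism H -> H}) :
  (forall h, f (ca h) = ca (f h)) -> forall h, f (ci h) = ci (f h).
Proof. by move=> fca h; rewrite -[in RHS](ciK h) fca caK. Qed.

Let fbi : {lrmorphism H -> H} := ci \o fb \o fb.
Let fci : {lrmorphism H -> H} := ci \o fc.

Fixpoint B3ev (p : B3term) : {lrmorphism H -> H} * {lrmorphism H -> H} :=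
  match p with
  | BOne => (idfun : {lrmorphism H -> H}, idfun : {lrmorphism H -> H})
  | Bb => (fb, fbi)
  | Bc => (fc, fci)
  | BMul p q => ((B3ev p).1 \o (B3ev q).1 : {lrmorphism H -> H},
                 (B3ev q).2 \o (B3ev p).2 : {lrmorphism H -> H})
  | BInv p => ((B3ev p).2, (B3ev p).1)
  end.

Let B3evK p : cancel (B3ev p).1 (B3ev p).2 /\ cancel (B3ev p).2 (B3ev p).1.
Proof.
elim: p => //=.
- split=> h.
    by change (ci ((fb \o fb \o fb) h) = h); rewrite fb3 caK.
  change (fb (ci (fb (fb h))) = h); rewrite (ci_comm fb_ca).
  by change (ci ((fb \o fb \o fb) h) = h); rewrite fb3 caK.
- split=> h.
    by change (ci ((fc \o fc) h) = h); rewrite fc2 caK.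
  change (fc (ci (fc h)) = h); rewrite (ci_comm fc_ca).
  by change (ci ((fc \o fc) h) = h); rewrite fc2 caK.
- by move=> p [IHp IHp'] q [IHq IHq']; split=> h /=; rewrite ?IHp ?IHq' ?IHq ?IHp'.
- by move=> p [].
Qed.

Let B3ev_cong p q : Bcong p q ->
  (B3ev p).1 =1 (B3ev q).1 /\ (B3ev p).2 =1 (B3ev q).2.
Proof.
have inv p1 q1 : (B3ev p1).1 =1 (B3ev q1).1 -> (B3ev p1).2 =1 (B3ev q1).2.
  move=> e h; apply: (can_inj (B3evK p1).1).
  by rewrite (B3evK p1).2 e (B3evK q1).2.
move=> pq; suff e1 : (B3ev p).1 =1 (B3ev q).1 by split=> //; apply: inv.
elim: pq => {p q} //=.
- by move=> h; change ((fb \o fb \o fb) h = (fc \o fc) h); rewrite fb3 fc2.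
- by move=> p q _ e h; rewrite e.
- by move=> p q r _ e1 _ e2 h; rewrite e1 e2.
- by move=> p p' q q' _ e1 _ e2 h /=; rewrite e2 e1.
- by move=> p p' _ /inv.
- by move=> p h; apply: (B3evK p).1.
- by move=> p h; apply: (B3evK p).2.
Qed.

Lemma B3_action_exists : exists act, @B3_action F act.
Proof.
pose act (g : B3) : {lrmorphism H -> H} := (B3ev (Brepr g)).1.
have actE p : act (Bpi p) =1 (B3ev p).1 by apply: (B3ev_cong (Brepr_pi p)).1.
have act1 : act 1%g =1 id by move=> h; apply: (actE BOne).
have actM g h : act (g * h)%g =1 act g \o act h.
  move=> x; elim/B3_ind: g => p; elim/B3_ind: h => q.
  by rewrite -BpiM /= !actE.
have [b0 b1 bv0 bv1] := fbP; have [c0 c1 cv0 cv1] := fcP.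
have ab : act B3b =1 fb by apply: (actE Bb).
have ac : act B3c =1 fc by apply: (actE Bc).
exists act; split=> //.
- move=> h; rewrite /B3a expgS expg2 actM /= actM /= !ab.
  by change ((fb \o fb \o fb) h = t1^-1 * h * t1); rewrite fb3.
all: by rewrite ?ab ?ac.
Qed.

End ActionExists.

(* Main.v *)
(** Write [tr u = u + u^-1].  For units [u], [v] with central [tr u], [tr v] the
    element [tr (u * v)] equals [tr (v * u)], hence commutes with [u] and [v];
    this gives the action of [a] and [b].  For the formula involving [z'], let
    [q = tv0 * t0 * tv1 * t1].  Centrality of [q] gives
    [y = q * (tv0 * t0)^-1 + q^-1 * (tv0 * t0)].  Expand [x * y] and [y * x]
    with the more convenient form of [x] in each summand; then all monomials
    pair up into multiples of the traces of [t0], [tv0] and [tv1]. *)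

Require Import Defs.
From HB Require Import structures.
From mathcomp Require Import all_boot all_algebra.

Import GRing.Theory.
Local Open Scope ring_scope.

Definition tr {R : unitRingType} (u : R) := u + u^-1.
Definition central {R : unitRingType} (u : R) := forall h, u * h = h * u.

Section CentralTrace.
Variable R : unitRingType.
Implicit Types u v : R.

(** Substitute [u^-1 = tr u - u] and [v^-1 = tr v - v]: once the central traces are moved aside,
    [u^-1 * v^-1 + v * u] is symmetric in [u] and [v]. *)
Lemma tr_mulC u v : u \is a GRing.unit -> v \is a GRing.unit ->
  central (tr u) -> central (tr v) -> tr (u * v) = tr (v * u).
Proof.
move=> uU vU cu cv; rewrite /tr !invrM //.
suff e : u^-1 * v^-1 + v * u = v^-1 * u^-1 + u * v by rewrite addrC -e addrC.
have Eu : u^-1 = tr u - u by rewrite /tr addrC addKr.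
have Ev : v^-1 = tr v - v by rewrite /tr addrC addKr.
rewrite Eu Ev !mulrBl !mulrBr !opprB -(cu v) (cv u) (cv (tr u)) !addrA.
by rewrite [LHS](ACl (1*4*5*2*3)).
Qed.

Lemma tr_conj u v : u \is a GRing.unit -> v \is a GRing.unit ->
  tr (u^-1 * v * u) = u^-1 * tr v * u.
Proof.
move=> uU vU.
have uVU : u^-1 \is a GRing.unit by rewrite unitrV.
by rewrite /tr !invrM ?unitrMl // invrK mulrDr mulrDl !mulrA.
Qed.

(** Expanding [tr (v * u)] instead of [tr (u * v)] gives a second expression for the same element;
    this is where the alternative forms of [x] and [z'] come from. *)
Lemma tr_mulE u v : u \is a GRing.unit -> v \is a GRing.unit ->
  central (tr u) -> central (tr v) -> tr (u * v) = v * u + u^-1 * v^-1.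
Proof. by move=> uU vU cu cv; rewrite tr_mulC // /tr invrM. Qed.

(** With [tr (v * u)] on the left, both sides expand to [v * u * v + u^-1]. *)
Lemma tr_mul_commr u v : u \is a GRing.unit -> v \is a GRing.unit ->
  central (tr u) -> central (tr v) -> tr (u * v) * v = v * tr (u * v).
Proof.
move=> uU vU cu cv; rewrite {1}tr_mulC // /tr !invrM // mulrDl mulrDr !mulrA.
by rewrite mulrVK // mulrV // mul1r.
Qed.

Lemma tr_mul_conj u v : u \is a GRing.unit -> v \is a GRing.unit ->
  central (tr u) -> central (tr v) -> v^-1 * tr (u * v) * v = tr (u * v).
Proof. by move=> uU vU cu cv; rewrite -mulrA tr_mul_commr // mulKr. Qed.

Lemma central_mulCA r u v : central r -> r * (u * v) = u * (r * v).
Proof. by move=> cr; rewrite !mulrA (cr u). Qed.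

Section Product.
(* [A], [B], [C], [D] stand for [tv0], [t0], [tv1], [t1]. *)
Variables A B C D : R.
Hypotheses (AU : A \is a GRing.unit) (BU : B \is a GRing.unit).
Hypotheses (CU : C \is a GRing.unit) (DU : D \is a GRing.unit).
Hypotheses (cA : central (tr A)) (cB : central (tr B)).
Hypotheses (cC : central (tr C)) (cD : central (tr D)).
Local Notation q := (A * B * C * D).
Hypothesis cq : central q.

Let qU : q \is a GRing.unit. Proof. by rewrite !unitrMl. Qed.
Let cqV : central q^-1.
Proof. by move=> h; apply/commr_sym/commrV/commr_sym/cq. Qed.

(** Free cancellation in left-associated words, hence used after [!mulrA]. *)
Let word_simp := (mulrK AU, mulrK BU, mulrK CU, mulrK DU,
                 mulrVK AU, mulrVK BU, mulrVK CU, mulrVK DU,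
                 mulVr AU, mulVr BU, mulVr CU, mulVr DU,
                 mulrV AU, mulrV BU, mulrV CU, mulrV DU, mul1r, mulr1).

Let qAB : q * (B^-1 * A^-1) = C * D.
Proof. by rewrite cq !mulrA !word_simp. Qed.

Let qVAB : q^-1 * (A * B) = D^-1 * C^-1.
Proof. by apply: (mulrI qU); rewrite mulVKr // !mulrA !word_simp. Qed.

Let x := tr (A * D).
Let y := tr (C * D).
Let z := tr (B * D).
Let z' := tr (A * B * A^-1 * D).

Let BAU : A * B * A^-1 \is a GRing.unit.
Proof. by rewrite !unitrMl ?unitrV. Qed.

Let VBA : (A * B * A^-1)^-1 = A * B^-1 * A^-1.
Proof. by rewrite !invrM ?unitrMl ?unitrV // invrK mulrA. Qed.

(** Conjugation fixes the central [tr B], so [tr_mulE] applies to [z'] as well. *)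
Let tr_BA : tr (A * B * A^-1) = tr B.
Proof. by rewrite /tr VBA -mulrDl -mulrDr -/(tr B) -cB mulrK. Qed.

Let z'E : z' = D * (A * B * A^-1) + A * B^-1 * A^-1 * D^-1.
Proof. by rewrite /z' tr_mulE ?tr_BA // VBA. Qed.

Let tr_BM u v : u * B * v + u * B^-1 * v = tr B * (u * v).
Proof. by rewrite -mulrDl -mulrDr -/(tr B) -cB mulrA. Qed.

Let xE : x = A * D + D^-1 * A^-1.
Proof. by rewrite /x /tr invrM. Qed.

Let xE' : x = D * A + A^-1 * D^-1.
Proof. exact: tr_mulE. Qed.

Let zE : z = B * D + D^-1 * B^-1.
Proof. by rewrite /z /tr invrM. Qed.

Let yE : y = q * (B^-1 * A^-1) + q^-1 * (A * B).
Proof. by rewrite qAB qVAB /y /tr invrM. Qed.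

(** The coefficient of [q] after [yE] is inserted. The form [xE'] supplies the monomial that pairs
    with one of [z'] into [tr B * D]; [B^-1 * A^-1] stays grouped so that [qAB] can absorb [q]. *)
Let xy_q : z' + x * (B^-1 * A^-1) =
  tr B * D + A^-1 * D^-1 * (B^-1 * A^-1) + A * (B^-1 * A^-1) * D^-1.
Proof.
have := tr_BM (D * A) A^-1; rewrite mulrK // => <-.
by rewrite z'E xE' mulrDl !mulrA !addrA [LHS](ACl (1*3*4*2)).
Qed.

(** The coefficient of [q^-1], now with the form [xE]. Here [B * D] is written [A^-1 * (A * B) * D]
    to expose the factor needed by [qVAB]. *)
Let xy_qV : z + x * (A * B) =
  tr B * D^-1 + A * D * (A * B) + A^-1 * (A * B) * D.
Proof.
have := tr_BM D^-1 1; rewrite !mulr1 mulKr // => <-.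
by rewrite zE xE mulrDl !mulrA !word_simp !addrA [LHS](ACl (4*2*3*1)).
Qed.

(** For [y * x] the roles of [z] and [z'] are exchanged: [z] goes with [q] and the form [xE], [z']
    with [q^-1] and the form [xE']. *)
Let yx_q : z + B^-1 * A^-1 * x =
  tr B * D + B^-1 * A^-1 * (D^-1 * A^-1) + D^-1 * (B^-1 * A^-1) * A.
Proof.
have := tr_BM 1 D; rewrite !mul1r => <-.
by rewrite zE xE mulrDr !mulrA !word_simp !addrA [LHS](ACl (1*3*4*2)).
Qed.

Let yx_qV : z' + A * B * x =
  tr B * D^-1 + A * B * (D * A) + D * (A * B) * A^-1.
Proof.
have := tr_BM A (A^-1 * D^-1); rewrite mulVKr // => <-.
by rewrite z'E xE' mulrDr !mulrA !addrA [LHS](ACl (4*2*3*1)).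
Qed.

Let rhs := tr A * tr C + tr B * (q * D + q^-1 * D^-1).

Lemma tr_xy : q^-1 * z + q * z' + x * y = rhs.
Proof.
have -> : q^-1 * z + q * z' + x * y =
    q * (z' + x * (B^-1 * A^-1)) + q^-1 * (z + x * (A * B)).
  rewrite yE (mulrDr x) (mulrDr q z') (mulrDr q^-1 z).
  rewrite -(central_mulCA q x) // -(central_mulCA q^-1 x) // !addrA.
  by rewrite [LHS](ACl (2*3*1*4)).
rewrite xy_q xy_qV.
have -> : q * (tr B * D + A^-1 * D^-1 * (B^-1 * A^-1) + A * (B^-1 * A^-1) * D^-1)
    = tr B * (q * D) + A^-1 * D^-1 * C * D + A * C.
  rewrite !mulrDr (central_mulCA q (tr B)) // (central_mulCA q (A^-1 * D^-1)) //.
  rewrite -(mulrA A (B^-1 * A^-1)) (central_mulCA q A) //.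
  by rewrite (mulrA q (B^-1 * A^-1)) qAB !mulrA !word_simp.
have -> : q^-1 * (tr B * D^-1 + A * D * (A * B) + A^-1 * (A * B) * D)
    = tr B * (q^-1 * D^-1) + A * C^-1 + A^-1 * D^-1 * C^-1 * D.
  rewrite !mulrDr (central_mulCA q^-1 (tr B)) // (central_mulCA q^-1 (A * D)) //.
  rewrite -(mulrA A^-1 (A * B)) (central_mulCA q^-1 A^-1) //.
  by rewrite (mulrA q^-1 (A * B)) qVAB !mulrA !word_simp.
rewrite /rhs.
have -> : tr A * tr C =
    A * C + A * C^-1 + A^-1 * D^-1 * C * D + A^-1 * D^-1 * C^-1 * D.
  (* Conjugating the central [tr C] by [D] changes nothing, but produces exactly the monomials left
     over above. *)
  have : A^-1 * tr C = A^-1 * D^-1 * tr C * D.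
    by rewrite -mulrA (cC D) mulrA mulrVK.
  by rewrite {1}/tr mulrDl => ->; rewrite /tr !mulrDr mulrDl !addrA.
by rewrite (mulrDr (tr B)) !addrA [LHS](ACl (3*5*2*6*1*4)).
Qed.

Lemma tr_yx : q * z + q^-1 * z' + y * x = rhs.
Proof.
have -> : q * z + q^-1 * z' + y * x =
    q * (z + B^-1 * A^-1 * x) + q^-1 * (z' + A * B * x).
  rewrite yE (mulrDl _ _ x) (mulrDr q z) (mulrDr q^-1 z').
  rewrite -(mulrA q _ x) -(mulrA q^-1 _ x) !addrA.
  by rewrite [LHS](ACl (1*3*2*4)).
rewrite yx_q yx_qV.
have -> : q * (tr B * D + B^-1 * A^-1 * (D^-1 * A^-1) + D^-1 * (B^-1 * A^-1) * A)
    = tr B * (q * D) + C * A^-1 + D^-1 * C * D * A.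
  rewrite !mulrDr (central_mulCA q (tr B)) // (mulrA q (B^-1 * A^-1)).
  rewrite -(mulrA D^-1 (B^-1 * A^-1)) (central_mulCA q D^-1) //.
  by rewrite (mulrA q (B^-1 * A^-1)) qAB !mulrA !word_simp.
have -> : q^-1 * (tr B * D^-1 + A * B * (D * A) + D * (A * B) * A^-1)
    = tr B * (q^-1 * D^-1) + C^-1 * A^-1 + D^-1 * C^-1 * D * A.
  rewrite !mulrDr (central_mulCA q^-1 (tr B)) // (mulrA q^-1 (A * B)).
  rewrite -(mulrA D (A * B)) (central_mulCA q^-1 D) //.
  by rewrite (mulrA q^-1 (A * B)) qVAB !mulrA !word_simp addrAC.
rewrite /rhs.
have -> : tr A * tr C =
    C * A^-1 + C^-1 * A^-1 + D^-1 * C * D * A + D^-1 * C^-1 * D * A.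
  (* The same conjugation by [D], now in the summand [tr C * A]. *)
  have e : tr C * A = D^-1 * tr C * D * A by rewrite -(mulrA D^-1) (cC D) mulKr.
  rewrite cA {2}/tr addrC (mulrDr (tr C)) e.
  by rewrite /tr mulrDr !mulrDl !addrA.
by rewrite (mulrDr (tr B)) !addrA [LHS](ACl (2*5*3*6*1*4)).
Qed.

End Product.

End CentralTrace.

Theorem theorem5p1 (F : fieldType) (act : B3 -> {lrmorphism Hhat F -> Hhat F})
    (act_spec : B3_action act) :
  [/\ act B3a Hx = Hx, act B3a Hy = Hy & act B3a Hz = Hz] /\
  [/\ act B3b Hx = Hy, act B3b Hy = Hz & act B3b Hz = Hx] /\
  (let z' := act B3c Hz in
   let rhs := (tv0 + tv0^-1) * (tv1 + tv1^-1)
              + (t0 + t0^-1) * (HQ^-1 * t1 + HQ * t1^-1) in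
   [/\ act B3c Hx = Hy, act B3c Hy = Hx,
       HQ * Hz + HQ^-1 * z' + Hx * Hy = rhs
     & HQ^-1 * Hz + HQ * z' + Hy * Hx = rhs]).
Proof.
have U u : Hgenv u \is a GRing.unit := Hgenv_unit F u.
have T u : central (tr (Hgenv u)) := @Hgenv_central F u.
have UM u v : Hgenv u * Hgenv v \is a @GRing.unit (Hhat F) by rewrite unitrMl.
have act_tr g u v : act g (tr (Hgenv u * Hgenv v)) =
    tr (act g (Hgenv u) * act g (Hgenv v)).
  by rewrite /tr rmorphD (rmorphV (act g) (UM u v)) rmorphM.
(* Both [b] and [c] send [tv0] to a conjugate of [tv1] by [t1]; the product with [t1] is then a
   conjugate of [tv1 * t1], whose trace commutes with [t1]. *)
have cyc u : tr (t1^-1 * Hgenv u * t1 * t1 : Hhat F) = tr (Hgenv u * t1).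
  by rewrite -(mulrA t1^-1 (Hgenv u)) tr_conj // tr_mul_conj.
have fix_a u : act B3a (tr (Hgenv u * t1)) = tr (Hgenv u * t1).
  by rewrite (B3act_a act_spec) tr_mul_conj.
have z'E : act B3c Hz = tr (tv0 * t0 * tv0^-1 * t1).
  by rewrite act_tr (B3act_c_t0 act_spec) (B3act_c_t1 act_spec).
split; first by split; apply: fix_a.
split.
  split; rewrite act_tr (B3act_b_t1 act_spec).
  - by rewrite (B3act_b_tv0 act_spec) cyc.
  - by rewrite (B3act_b_tv1 act_spec).
  - by rewrite (B3act_b_t0 act_spec).
(* Since [HQ] is [q^-1], the equation with [HQ * Hz] is [tr_xy] and the one with [HQ^-1 * Hz] is
   [tr_yx]. *)
rewrite /= z'E /HQ invrK; split.
- by rewrite act_tr (B3act_c_t1 act_spec) (B3act_c_tv0 act_spec) cyc.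
- by rewrite act_tr (B3act_c_t1 act_spec) (B3act_c_tv1 act_spec).
- by apply: tr_xy => //; apply: Hprod_central.
- by apply: tr_yx => //; apply: Hprod_central.
Qed.
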